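(* Let $b,\alpha\in\mathbb C$, $\lambda\in\mathbb C^*$, $h(t)\in\mathbb C[t]$. The $\mathscr V$-module $\Phi(\lambda,\alpha,h)$ is irreducible if and only if $b=-1$, $\alpha\neq0$ and $\deg h(t)=1$.
   Context: $\mathscr V$ is the Virasoro algebra: the complex Lie algebra with basis $\{L_m,C\mid m\in\mathbb Z\}$ and brackets $[L_m,L_n]=(n-m)L_{m+n}+\delta_{m+n,0}\frac{m^3-m}{12}C$, $[L_m,C]=0$. For $b\in\mathbb C$, $W(0,b)$ is the complex Lie algebra with basis $\{L_m,W_m\mid m\in\mathbb Z\}$ and brackets $[L_m,L_n]=(n-m)L_{m+n}$, $[L_m,W_n]=(n+bm)W_{m+n}$, $[W_m,W_n]=0$. For $\lambda\in\mathbb C^*$, $\alpha\in\mathbb C$, $h=h(t)\in\mathbb C[t]$, put $g(t)=\frac{h(t)-h(\alpha)}{t-\alpha}\in\mathbb C[t]$ and $h_m(t)=mh(t)-m\alpha\big(\delta_{b,-1}(m-1)+\delta_{b,1}\big)g(t)$ for $m\in\mathbb Z$. The $W(0,b)$-module $\Phi(\lambda,\alpha,h)$ is the polynomial space $\mathbb C[s,t]$ with action $$L_mf(s,t)=\lambda^m\Big(\big(s+h_m(t)\big)f(s-m,t)+bm\big(t-\delta_{b,-1}m\alpha-\delta_{b,1}\alpha\big)\tfrac{\partial}{\partial t}f(s-m,t)\Big),$$ $$W_mf(s,t)=\lambda^m\big(t-\delta_{b,-1}m\alpha-\delta_{b,1}(1-\delta_{m,0})\alpha\big)f(s-m,t)$$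 for $m\in\mathbb Z$, $f(s,t)\in\mathbb C[s,t]$. It is regarded as a $\mathscr V$-module by letting each $L_m\in\mathscr V$ ($m\in\mathbb Z$) act by $L_mf(s,t)=\lambda^m\Big(\big(s+h_m(t)\big)f(s-m,t)+bm\big(t-\delta_{b,-1}m\alpha-\delta_{b,1}\alpha\big)\tfrac{\partial}{\partial t}f(s-m,t)\Big)$ for $f(s,t)\in\mathbb C[s,t]$, with $C$ acting as $0$. *)

(* Defs.v *)
From HB Require Import structures.
From mathcomp Require Import all_boot all_order all_algebra.
From mathcomp Require Import finmap complex reals.
From mathcomp Require monalg mpoly.
From mathcomp Require Import ring.

Set Implicit Arguments.
Unset Strict Implicit.
Unset Printing Implicit Defensive.

Import Order.TTheory GRing.Theory Num.Theory.
Local Open Scope ring_scope.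

Record lieAlgebra (K : fieldType) := LieAlgebra {
  lie_sort :> lmodType K;
  lie_bracket : lie_sort -> lie_sort -> lie_sort;
  lie_bracket_linearl : forall y, linear (lie_bracket^~ y);
  lie_bracket_linearr : forall x, linear (lie_bracket x);
  lie_bracketxx : forall x, lie_bracket x x = 0;
  lie_jacobi : forall x y z,
    lie_bracket x (lie_bracket y z) + lie_bracket y (lie_bracket z x)
      + lie_bracket z (lie_bracket x y) = 0 }.

Record lieModule (K : fieldType) (L : lieAlgebra K) := LieModule {
  liemod_sort :> lmodType K;
  lie_act : L -> liemod_sort -> liemod_sort;
  lie_act_linearl : forall v, linear (lie_act^~ v);
  lie_act_linearr : forall x, linear (lie_act x);
  lie_act_bracket : forall x y v,
    lie_act (lie_bracket x y) v =
      lie_act x (lie_act y v) - lie_act y (lie_act x v) }.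

Record is_submodule (K : fieldType) (L : lieAlgebra K) (M : lieModule L)
    (N : M -> Prop) : Prop := IsSubmodule {
  submodule0 : N 0;
  submoduleP : forall (a : K) u v, N u -> N v -> N (a *: u + v);
  submodule_act : forall (x : L) v, N v -> N (lie_act x v) }.

Definition irreducible (K : fieldType) (L : lieAlgebra K) (M : lieModule L) :
    Prop :=
  (exists v : M, v <> 0) /\
  forall N : M -> Prop, is_submodule N ->
    (forall v, N v -> v = 0) \/ (forall v, N v).

Lemma addrACA3 (V : zmodType) (u1 u2 u3 v1 v2 v3 : V) :
  (u1 + v1) + (u2 + v2) + (u3 + v3) = (u1 + u2 + u3) + (v1 + v2 + v3).
Proof. by rewrite (addrACA u1) (addrACA (u1 + u2)). Qed.

(* monalg and mpoly have clashing notations, so each is imported only in the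
   sections that need it. *)
Section LinExt.
Import monalg.
Variables (K : fieldType) (I : choiceType).

(* The linear extension of F to the space with basis I. *)
Definition lin_ext (V : lmodType K) (F : I -> V) (x : {malg K[I]}) : V :=
  \sum_(i <- msupp x) x@_i *: F i.

Implicit Types (V : lmodType K) (x : {malg K[I]}).

Lemma lin_extEw V (F : I -> V) (d : {fset I}) x :
  (msupp x `<=` d)%fset -> lin_ext F x = \sum_(i <- d) x@_i *: F i.
Proof.
move=> le; rewrite /lin_ext (big_fset_incl _ le) // => i _ /mcoeff_outdom ->.
by rewrite scale0r.
Qed.

Lemma lin_ext_linear V (F : I -> V) : linear (lin_ext F).
Proof.
move=> a x y.
pose d := (msupp x `|` msupp y `|` msupp (a *: x + y))%fset.
have dx : (msupp x `<=` d)%fset by rewrite /d -fsetUA fsubsetUl.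
have dy : (msupp y `<=` d)%fset by rewrite /d fsubsetU ?fsubsetUr.
have dxy : (msupp (a *: x + y) `<=` d)%fset by rewrite /d fsubsetUr.
rewrite (lin_extEw _ dx) (lin_extEw _ dy) (lin_extEw _ dxy).
rewrite scaler_sumr -big_split /=; apply: eq_bigr => i _.
by rewrite mcoeffD mcoeffZ scalerDl scalerA.
Qed.

Lemma lin_extU V (F : I -> V) i : lin_ext F << i >> = F i.
Proof. by rewrite /lin_ext msuppU oner_eq0 big_seq_fset1 mcoeffUU scale1r. Qed.

Lemma eq_lin_ext V (F G : I -> V) x : F =1 G -> lin_ext F x = lin_ext G x.
Proof. by move=> FG; apply: eq_bigr => i _; rewrite FG. Qed.

Lemma lin_ext_linearF (V W : lmodType K) (F : I -> W -> V) x : (forall i, linear (F i)) ->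
  linear (fun w => lin_ext (F^~ w) x).
Proof.
move=> lF a u v; rewrite /lin_ext scaler_sumr -big_split /=.
apply: eq_bigr => i _.
by rewrite lF scalerDr !scalerA mulrC.
Qed.

Lemma malg_basis_ind (P : {malg K[I]} -> Prop) :
  P 0 -> (forall a x y, P x -> P y -> P (a *: x + y)) ->
  (forall i, P << i >>) -> forall x, P x.
Proof.
move=> P0 PL PU x; rewrite (monalgE x).
elim/big_ind: _ => // [y z Py Pz | i _].
  by rewrite -[y]scale1r; apply: PL.
suff -> : << x@_i *g i >> = x@_i *: << i >> + 0 :> {malg K[I]} by apply: PL.
rewrite addr0; apply/malgP => k.
by rewrite mcoeffZ !mcoeffU mulr_natr.
Qed.

End LinExt.

Section Virasoro.
Import monalg.
Variable K : numFieldType.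

(* The basis is indexed by option int: Some m stands for L_m, None for C. *)
Definition vir_space : lmodType K := {malg K[option int]}.
Definition vir_basis (i : option int) : vir_space := << i >>.
Definition vir_L (m : int) : vir_space := vir_basis (Some m).
Definition vir_C : vir_space := vir_basis None.

Definition vir_basis_bracket (i j : option int) : vir_space :=
  match i, j with
  | Some m, Some n =>
      (n - m)%:~R *: vir_L (m + n)
        + ((m + n == 0)%:R * ((m%:~R ^+ 3 - m%:~R) / 12)) *: vir_C
  | _, _ => 0
  end.

Definition vir_bracket (x y : vir_space) : vir_space :=
  lin_ext (fun i => lin_ext (vir_basis_bracket i) y) x.

Lemma vir_bracket_linearl y : linear (vir_bracket^~ y).
Proof. exact: lin_ext_linear. Qed.

Lemma vir_bracket_linearr x : linear (vir_bracket x).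
Proof. by apply: lin_ext_linearF => i; apply: lin_ext_linear. Qed.

Lemma vir_bracketU i j : vir_bracket << i >> << j >> = vir_basis_bracket i j.
Proof. by rewrite /vir_bracket !lin_extU. Qed.

Lemma vir_bracket0l y : vir_bracket 0 y = 0.
Proof. by rewrite /vir_bracket /lin_ext msupp0 big_seq_fset0. Qed.
Lemma vir_bracket0r x : vir_bracket x 0 = 0.
Proof.
rewrite /vir_bracket /lin_ext big1 // => i _.
by rewrite msupp0 big_seq_fset0 scaler0.
Qed.
Lemma vir_bracketDl y : {morph vir_bracket^~ y : u v / u + v}.
Proof. by move=> u v; have := vir_bracket_linearl y 1 u v; rewrite !scale1r. Qed.
Lemma vir_bracketDr x : {morph vir_bracket x : u v / u + v}.
Proof. by move=> u v; have := vir_bracket_linearr x 1 u v; rewrite !scale1r. Qed.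
Lemma vir_bracketZl y a u : vir_bracket (a *: u) y = a *: vir_bracket u y.
Proof.
by have := vir_bracket_linearl y a u 0; rewrite /= vir_bracket0l !addr0.
Qed.
Lemma vir_bracketZr x a u : vir_bracket x (a *: u) = a *: vir_bracket x u.
Proof.
by have := vir_bracket_linearr x a u 0; rewrite /= vir_bracket0r !addr0.
Qed.
Definition vir_bracketE := (vir_bracketDl, vir_bracketDr, vir_bracketZl,
  vir_bracketZr, vir_bracket0l, vir_bracket0r).

Lemma vir_bracket_skew x y : vir_bracket x y = - vir_bracket y x.
Proof.
elim/malg_basis_ind: x => [|a u v IHu IHv|i].
- by rewrite !vir_bracketE oppr0.
- by rewrite !vir_bracketE IHu IHv scalerN opprD.
elim/malg_basis_ind: y => [|a u v IHu IHv|j].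
- by rewrite !vir_bracketE oppr0.
- by rewrite !vir_bracketE IHu IHv scalerN opprD.
rewrite !vir_bracketU; case: i j => [m|] [n|] //=; rewrite ?oppr0 //.
have -> : (m - n)%:~R = - (n - m)%:~R :> K by rewrite -(opprB n m) rmorphN.
rewrite (addrC n m); set y := (X in _ + X *: _); set z := (X in - (_ + X *: _)).
suff -> : z = - y by rewrite 2!scaleNr -opprD opprK.
rewrite {}/y {}/z.
case: (eqVneq (m + n) 0) => [/eqP|_]; last by rewrite !mul0r oppr0.
by rewrite addr_eq0 => /eqP ->; rewrite rmorphN; ring.
Qed.

Lemma vir_bracketxx x : vir_bracket x x = 0.
Proof.
have /eqP := vir_bracket_skew x x.
rewrite -addr_eq0 -mulr2n -scaler_nat scaler_eq0 pnatr_eq0 /=.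
by move/eqP.
Qed.

Lemma vir_jacobi x y z :
  vir_bracket x (vir_bracket y z) + vir_bracket y (vir_bracket z x)
    + vir_bracket z (vir_bracket x y) = 0.
Proof.
have lin (a : K) (u1 u2 u3 v1 v2 v3 : vir_space) :
    u1 + u2 + u3 = 0 -> v1 + v2 + v3 = 0 ->
    (a *: u1 + v1) + (a *: u2 + v2) + (a *: u3 + v3) = 0.
  move=> hu hv; rewrite addrACA3 -!scalerDr.
  by rewrite hu hv scaler0 addr0.
elim/malg_basis_ind: x => [|a u v IHu IHv|i].
- by rewrite !vir_bracketE !addr0.
- by rewrite !vir_bracketE; apply: lin.
elim/malg_basis_ind: y => [|a u v IHu IHv|j].
- by rewrite !vir_bracketE !addr0.
- by rewrite !vir_bracketE; apply: lin.
elim/malg_basis_ind: z => [|a u v IHu IHv|k].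
- by rewrite !vir_bracketE !addr0.
- by rewrite !vir_bracketE; apply: lin.
have br0l p : vir_bracket << None >> << p >> = 0 by rewrite vir_bracketU.
have br0r p : vir_bracket << p >> << None >> = 0.
  by rewrite vir_bracketU; case: p.
case: i => [m|]; last first.
  rewrite br0l br0r !vir_bracketE !addr0 vir_bracketU.
  case: j k => [n|] [k|] /=; rewrite ?vir_bracketE //.
  by rewrite !br0l !scaler0 addr0.
case: j => [n|]; last first.
  rewrite br0l br0r !vir_bracketE add0r addr0 vir_bracketU.
  case: k => [k|] /=; rewrite ?vir_bracketE //.
  by rewrite !br0l !scaler0 addr0.
case: k => [k|]; last first.
  rewrite br0l br0r !vir_bracketE !add0r vir_bracketU /=.
  by rewrite ?vir_bracketE !br0l !scaler0 addr0.
have E (p q r : int) :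
    vir_bracket << Some p >> (vir_bracket << Some q >> << Some r >>) =
      ((r - q)%:~R * (q + r - p)%:~R) *: vir_L (p + (q + r))
      + ((r - q)%:~R * ((p + (q + r) == 0)%:R * ((p%:~R ^+ 3 - p%:~R) / 12)))
          *: vir_C.
  rewrite (vir_bracketU (Some q)) /= vir_bracketDr !vir_bracketZr br0r.
  by rewrite scaler0 addr0 vir_bracketU /= scalerDr !scalerA.
rewrite !E.
have -> : n + (k + m) = m + (n + k) by ring.
have -> : k + (m + n) = m + (n + k) by ring.
rewrite addrACA3 -!scalerDl.
rewrite [X in X *: vir_L _](_ : _ = 0); last by rewrite !rmorphB !rmorphD; ring.
rewrite [X in X *: vir_C](_ : _ = 0) ?scale0r ?addr0 //.
case: eqVneq => [|_]; last by rewrite !(mul0r, mulr0) !addr0.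
rewrite addrC => /eqP; rewrite addr_eq0 => /eqP hm.
have -> : m = - (n + k) by rewrite hm opprK.
by rewrite !(rmorphN, rmorphD, rmorphB); ring.
Qed.

Lemma vir_space_ind (P : vir_space -> Prop) :
  P 0 -> (forall a x y, P x -> P y -> P (a *: x + y)) ->
  (forall i, P (vir_basis i)) -> forall x, P x.
Proof. exact: malg_basis_ind. Qed.

Lemma vir_bracket_basis i j :
  vir_bracket (vir_basis i) (vir_basis j) = vir_basis_bracket i j.
Proof. exact: vir_bracketU. Qed.

Lemma lin_ext_basis (V : lmodType K) (F : option int -> V) i :
  lin_ext F (vir_basis i) = F i.
Proof. exact: lin_extU. Qed.

Definition virasoro : lieAlgebra K :=
  LieAlgebra vir_bracket_linearl vir_bracket_linearr vir_bracketxx vir_jacobi.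

End Virasoro.

Section Phi.
Import mpoly.
Variable K : numFieldType.

(* C[s, t] is {mpoly K[2]}. *)
Definition si : 'I_2 := ord0.
Definition ti : 'I_2 := ord_max.
Local Notation s := ('X_si : {mpoly K[2]}).
Local Notation t := ('X_ti : {mpoly K[2]}).

Definition at_t (p : {poly K}) : {mpoly K[2]} := (map_poly (@mpolyC 2 K) p).[t].

(* f(s, t) |-> f(s - m, t) *)
Definition shift_s (m : int) (f : {mpoly K[2]}) : {mpoly K[2]} :=
  f \mPo [tuple s - (m%:~R)%:MP; t].

Section Action.
Variables (b lambda alpha : K) (h : {poly K}).

Definition phi_g : {poly K} := (h - h.[alpha]%:P) %/ ('X - alpha%:P).

Definition phi_h (m : int) : {poly K} :=
  m%:~R *: h
    - (m%:~R * alpha * ((b == -1)%:R * (m%:~R - 1) + (b == 1)%:R)) *: phi_g.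

Definition phi_L (m : int) (f : {mpoly K[2]}) : {mpoly K[2]} :=
  lambda ^ m *:
    ((s + at_t (phi_h m)) * shift_s m f
     + (b * m%:~R) *:
         ((t - ((b == -1)%:R * m%:~R * alpha)%:MP - ((b == 1)%:R * alpha)%:MP)
          * (shift_s m f)^`M(ti))).

Definition phi_basis_act (i : option int) (f : {mpoly K[2]}) : {mpoly K[2]} :=
  if i is Some m then phi_L m f else 0.

Definition phi_act (x : virasoro K) (f : {mpoly K[2]}) : {mpoly K[2]} :=
  lin_ext (phi_basis_act^~ f) x.

End Action.

Lemma mpoly2_ind (P : {mpoly K[2]} -> Prop) :
  (forall c, P c%:MP) -> P s -> P t ->
  (forall f g, P f -> P g -> P (f + g)) ->
  (forall f g, P f -> P g -> P (f * g)) -> forall f, P f.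
Proof.
move=> PC Ps Pt PD PM f; rewrite [f]mpolyE.
elim/big_ind: _ => [|//|m _]; first by rewrite -[0]mpolyC0; apply: (PC).
rewrite -mul_mpolyC; apply: (PM) => //.
rewrite mpolyXE_id; elim/big_ind: _ => [|x y|i _].
- by rewrite -mpolyC1; apply: (PC).
- exact: (PM).
have Pi : P 'X_i.
  case: i => [[|[|//]] lt_i].
  - by rewrite (_ : Ordinal lt_i = si) //; apply: val_inj.
  - by rewrite (_ : Ordinal lt_i = ti) //; apply: val_inj.
elim: (m i) => [|k IHk]; first by rewrite expr0 -mpolyC1; apply: (PC).
by rewrite exprS; apply: (PM).
Qed.

Lemma scaleMP (c : K) (f : {mpoly K[2]}) : c *: f = c%:MP * f.
Proof. by rewrite -mul_mpolyC. Qed.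

Lemma shift_sC m c : shift_s m c%:MP = c%:MP.
Proof. exact: comp_mpolyC. Qed.

Lemma shift_ss m : shift_s m s = s - (m%:~R)%:MP.
Proof. by rewrite /shift_s comp_mpolyXU. Qed.

Lemma shift_st m : shift_s m t = t.
Proof. by rewrite /shift_s comp_mpolyXU. Qed.

Lemma shift_sD m : {morph shift_s m : f g / f + g}.
Proof. exact: comp_mpolyD. Qed.

Lemma shift_sM m : {morph shift_s m : f g / f * g}.
Proof. by move=> f g; rewrite /shift_s rmorphM. Qed.

Lemma shift_sZ m c f : shift_s m (c *: f) = c *: shift_s m f.
Proof. exact: comp_mpolyZ. Qed.

Lemma shift_sB m : {morph shift_s m : f g / f - g}.
Proof. exact: comp_mpolyB. Qed.

Lemma shift_s_add m n f : shift_s m (shift_s n f) = shift_s (m + n) f.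
Proof.
elim/mpoly2_ind: f => [c|||f g IHf IHg|f g IHf IHg].
- by rewrite !shift_sC.
- by rewrite !shift_ss shift_sB shift_ss shift_sC rmorphD mpolyCD opprD addrA.
- by rewrite !shift_st.
- by rewrite !shift_sD IHf IHg.
- by rewrite !shift_sM IHf IHg.
Qed.

Lemma mderivt_s : s^`M(ti) = 0.
Proof. by rewrite mderivX mnmE /= scale0r. Qed.

Lemma mderivt_t : t^`M(ti) = 1.
Proof. rewrite mderivX mnmE eqxx scale1r -mpolyX0; congr mpolyX; apply/mnmP => i.
by rewrite !mnmE subnn. Qed.

Lemma mderivt_shift m f : (shift_s m f)^`M(ti) = shift_s m f^`M(ti).
Proof.
elim/mpoly2_ind: f => [c|||f g IHf IHg|f g IHf IHg].
- by rewrite shift_sC !mderivC -mpolyC0 shift_sC.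
- by rewrite shift_ss mderivB mderivC mderivt_s subr0 -mpolyC0 shift_sC.
- by rewrite shift_st mderivt_t -mpolyC1 shift_sC.
- by rewrite shift_sD !mderivD shift_sD IHf IHg.
- by rewrite shift_sM !mderivM IHf IHg shift_sD !shift_sM.
Qed.

Lemma at_tD : {morph at_t : p q / p + q}.
Proof. by move=> p q; rewrite /at_t rmorphD hornerD. Qed.

Lemma at_tB : {morph at_t : p q / p - q}.
Proof. by move=> p q; rewrite /at_t rmorphB hornerD hornerN. Qed.

Lemma at_tM : {morph at_t : p q / p * q}.
Proof. by move=> p q; rewrite /at_t rmorphM hornerM. Qed.

Lemma at_tC c : at_t c%:P = c%:MP.
Proof. by rewrite /at_t map_polyC hornerC. Qed.

Lemma at_tX : at_t 'X = t.
Proof. by rewrite /at_t map_polyX hornerX. Qed.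

Lemma at_tZ c p : at_t (c *: p) = c%:MP * at_t p.
Proof. by rewrite -mul_polyC at_tM at_tC. Qed.

Lemma shift_at_t m p : shift_s m (at_t p) = at_t p.
Proof.
elim/poly_ind: p => [|p c IHp]; first by rewrite -[0]polyC0 at_tC shift_sC.
by rewrite at_tD at_tM at_tX at_tC shift_sD shift_sM IHp shift_st shift_sC.
Qed.

Lemma mderivt_at_t p : (at_t p)^`M(ti) = at_t p^`().
Proof.
elim/poly_ind: p => [|p c IHp].
  by rewrite deriv0 -[0]polyC0 at_tC mderivC -mpolyC0.
rewrite derivD derivM derivX derivC mulr1 addr0.
rewrite 2!at_tD !at_tM at_tX at_tC mderivD mderivM IHp mderivC mderivt_t.
by rewrite mulr1 addr0.
Qed.

Section Module.
Variables (b lambda alpha : K) (h : {poly K}).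

Lemma phi_gP : h = h.[alpha]%:P + ('X - alpha%:P) * phi_g alpha h.
Proof.
rewrite mulrC divpK ?subrKC // dvdp_XsubCl rootE !hornerE subrr //.
Qed.

Lemma scale_mul_linear (A : comAlgType K) (a c e : K) (p q u v u' v' : A) :
  c *: (p * (a *: u + v) + e *: (q * (a *: u' + v'))) =
    a *: (c *: (p * u + e *: (q * u'))) + c *: (p * v + e *: (q * v')).
Proof.
rewrite !mulrDr -!scalerAr [e *: _]scalerDr addrACA scalerDr.
congr (_ + _).
by rewrite (scalerA e) (mulrC e) -scalerA -scalerDr !scalerA (mulrC c).
Qed.

Lemma phi_L_linear m : linear (phi_L b lambda alpha h m).
Proof.
move=> a f g; rewrite /phi_L shift_sD shift_sZ mderivD mderivZ.
exact: scale_mul_linear.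
Qed.

Lemma phi_act_linearl f : linear ((phi_act b lambda alpha h)^~ f).
Proof. exact: lin_ext_linear. Qed.

Lemma phi_act_linearr x : linear (phi_act b lambda alpha h x).
Proof.
apply: lin_ext_linearF => -[m|]; first exact: phi_L_linear.
by move=> a f g; rewrite scaler0 addr0.
Qed.

Lemma phi_act_basis i f :
  phi_act b lambda alpha h (vir_basis K i) f =
    phi_basis_act b lambda alpha h i f.
Proof. exact: lin_ext_basis. Qed.

Hypothesis lambda_neq0 : lambda != 0.

Definition phi_e (m : int) : {poly K} :=
  (b * m%:~R) *:
    ('X - ((b == -1)%:R * m%:~R * alpha)%:P - ((b == 1)%:R * alpha)%:P).

Lemma phi_LE m f :
  phi_L b lambda alpha h m f =
    (lambda ^ m)%:MP * ((s + at_t (phi_h b alpha h m)) * shift_s m f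
                        + at_t (phi_e m) * shift_s m f^`M(ti)).
Proof.
rewrite /phi_L /phi_e at_tZ !at_tB at_tX !at_tC !scaleMP mderivt_shift.
by rewrite mulrA.
Qed.

Lemma eqN11 : (-1 == 1 :> K) = false.
Proof. by rewrite eq_sym -subr_eq0 opprK -(natrD _ 1 1) pnatr_eq0. Qed.

Lemma phi_e_bracket m n :
  (n - m)%:~R%:P * phi_e (m + n) =
    n%:~R%:P * phi_e n - m%:~R%:P * phi_e m
    + phi_e m * (phi_e n)^`() - phi_e n * (phi_e m)^`().
Proof.
rewrite /phi_e !derivZ !derivB !derivX !derivC !subr0 -!mul_polyC.
rewrite !rmorphB !rmorphD /=.
move: (m%:~R) (n%:~R) => M N.
case: (eqVneq b (-1)) => [->|bN1]; first by rewrite eqN11 /=; ring.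
by case: (eqVneq b 1) => [->|b1] /=; ring.
Qed.

Lemma phi_h_bracket m n :
  (n - m)%:~R%:P * phi_h b alpha h (m + n) =
    n%:~R%:P * phi_h b alpha h n - m%:~R%:P * phi_h b alpha h m
    + phi_e m * (phi_h b alpha h n)^`() - phi_e n * (phi_h b alpha h m)^`().
Proof.
rewrite /phi_h /phi_e; have := phi_gP.
move: (phi_g alpha h) (h.[alpha]) => g c ->.
rewrite !(derivB, derivZ, derivD, derivM, derivX, derivC) -!mul_polyC.
rewrite !rmorphB !rmorphD /=.
move: (m%:~R) (n%:~R) => M N; move: g^`() => g'.
case: (eqVneq b (-1)) => [->|bN1]; first by rewrite eqN11 /=; ring.
by case: (eqVneq b 1) => [->|b1] /=; ring.
Qed.

Lemma phi_L_comp m n f :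
  phi_L b lambda alpha h m (phi_L b lambda alpha h n f) =
    (lambda ^ m)%:MP * (lambda ^ n)%:MP *
     ((s + at_t (phi_h b alpha h m)) *
        ((s - (m%:~R)%:MP + at_t (phi_h b alpha h n)) * shift_s (m + n) f
         + at_t (phi_e n) * shift_s (m + n) f^`M(ti))
      + at_t (phi_e m) *
        ((s - (m%:~R)%:MP + at_t (phi_h b alpha h n))
           * shift_s (m + n) f^`M(ti)
         + at_t (phi_h b alpha h n)^`() * shift_s (m + n) f
         + at_t (phi_e n)^`() * shift_s (m + n) f^`M(ti)
         + at_t (phi_e n) * shift_s (m + n) f^`M(ti)^`M(ti))).
Proof.
rewrite phi_LE -mderivt_shift !phi_LE.
move: (at_t (phi_h _ _ _ m)) (at_t (phi_e m)) => Hm Em.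
have -> : shift_s m ((lambda ^ n)%:MP *
     ((s + at_t (phi_h b alpha h n)) * shift_s n f +
      at_t (phi_e n) * shift_s n f^`M(ti))) =
   (lambda ^ n)%:MP *
     ((s - (m%:~R)%:MP + at_t (phi_h b alpha h n)) * shift_s (m + n) f +
      at_t (phi_e n) * shift_s (m + n) f^`M(ti)).
  rewrite shift_sM shift_sC shift_sD [shift_s m (_ * _)]shift_sM.
  rewrite [shift_s m (at_t _ * _)]shift_sM shift_sD shift_ss !shift_at_t.
  by rewrite !shift_s_add.
rewrite mderivM mderivC mul0r add0r mderivD.
rewrite [((_ + _) * _)^`M(ti)]mderivM [(at_t _ * _)^`M(ti)]mderivM.
rewrite [(_ + at_t _)^`M(ti)]mderivD mderivB mderivC mderivt_s subr0 add0r.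
rewrite !mderivt_at_t !mderivt_shift.
ring.
Qed.

Lemma commutator_identity (R : comPzRingType)
    (k M N c d x H Hm Hn Hm' Hn' E Em En Em' En' F F1 F2 : R) :
  k = N - M ->
  k * H = N * Hn - M * Hm + Em * Hn' - En * Hm' ->
  k * E = N * En - M * Em + Em * En' - En * Em' ->
  k * (c * d * ((x + H) * F + E * F1)) =
    c * d * ((x + Hm) * ((x - M + Hn) * F + En * F1)
      + Em * ((x - M + Hn) * F1 + Hn' * F + En' * F1 + En * F2))
    - d * c * ((x + Hn) * ((x - N + Hm) * F + Em * F1)
      + En * ((x - N + Hm) * F1 + Hm' * F + Em' * F1 + Em * F2)).
Proof.
move=> hk hH hE.
have -> : k * (c * d * ((x + H) * F + E * F1)) =
    c * d * (k * x * F + (k * H) * F + (k * E) * F1) by ring.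
by rewrite hH hE hk; ring.
Qed.

Lemma phi_L_bracket m n f :
  (n - m)%:~R *: phi_L b lambda alpha h (m + n) f =
    phi_L b lambda alpha h m (phi_L b lambda alpha h n f)
    - phi_L b lambda alpha h n (phi_L b lambda alpha h m f).
Proof.
have := congr1 at_t (phi_e_bracket m n).
have := congr1 at_t (phi_h_bracket m n).
rewrite at_tB at_tD at_tB !at_tM !at_tC => hH.
rewrite at_tB at_tD at_tB !at_tM !at_tC => hE.
rewrite !phi_L_comp scaleMP phi_LE expfzDr // mpolyCM [n + m]addrC.
apply: commutator_identity hE; last first.
  by rewrite hH; congr (_ + _ - _); rewrite at_tB !at_tM !at_tC.
by rewrite !rmorphB.
Qed.

Lemma phi_act_bracket x y f :
  phi_act b lambda alpha h (lie_bracket x y) f =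
    phi_act b lambda alpha h x (phi_act b lambda alpha h y f)
    - phi_act b lambda alpha h y (phi_act b lambda alpha h x f).
Proof.
change (lie_bracket x y) with (vir_bracket x y).
pose act := phi_act b lambda alpha h; rewrite -/act.
have linl a u v g : act (a *: u + v) g = a *: act u g + act v g.
  exact: phi_act_linearl.
have linr z a g1 g2 : act z (a *: g1 + g2) = a *: act z g1 + act z g2.
  exact: phi_act_linearr.
have act0l g : act 0 g = 0.
  by have := linl (-1) 0 0 g; rewrite scaler0 addr0 scaleN1r addNr.
have act0r z : act z 0 = 0.
  by have := linr z (-1) 0 0; rewrite scaler0 addr0 scaleN1r addNr.
have act_basis i g : act (vir_basis K i) g = phi_basis_act b lambda alpha h i g.
  exact: phi_act_basis.
elim/vir_space_ind: x => [|a u v IHu IHv|i].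
- by rewrite vir_bracket0l !act0l act0r subrr.
- rewrite vir_bracket_linearl linl IHu IHv (linl a u v f).
  by rewrite (linl a u v (act y f)) linr scalerBr opprD addrACA.
elim/vir_space_ind: y => [|a u v IHu IHv|j].
- by rewrite vir_bracket0r !act0l act0r subrr.
- rewrite (vir_bracket_linearr (vir_basis K i) a u v) linl IHu IHv.
  rewrite (linl a u v f).
  rewrite (linl a u v (act _ f)) linr.
  by rewrite scalerBr opprD addrACA.
rewrite vir_bracket_basis (act_basis i) (act_basis j).
rewrite (act_basis i) (act_basis j).
have phi_L0 m : phi_L b lambda alpha h m 0 = 0.
  by have := phi_L_linear m (-1) 0 0; rewrite scaler0 addr0 scaleN1r addNr.
case: i j => [m|] [n|]; last by rewrite (act0l f) subrr.
- rewrite (linl (n - m)%:~R (vir_L K (m + n))).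
  rewrite -[_ *: vir_C K]addr0 (linl _ (vir_C K)) (act0l f) (act_basis _ f).
  rewrite (act_basis _ f) /= scaler0 !addr0.
  exact: phi_L_bracket.
- by rewrite (act0l f) /= phi_L0 subrr.
- by rewrite (act0l f) /= phi_L0 subrr.
Qed.

Definition Phi : lieModule (virasoro K) :=
  LieModule phi_act_linearl phi_act_linearr phi_act_bracket.

End Module.
End Phi.

(* Main.v *)
(* For b = -1 put D = d/dt - g(t) and k = h(alpha). Since h = k + (t - alpha) g,
     lambda^-m L_m f = (s + m k) f(s - m, t) + (m^2 alpha - m t) D f(s - m, t).
   Hence ker D (for h constant, where D = d/dt) and im D (for deg h >= 2, where D
   is not surjective) are proper submodules. If deg h = 1, then g is a nonzero
   constant; a subspace contains the coefficients of any polynomial in m whose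
   values it contains, so a nonzero submodule N meets C[t], N /\ C[t] is stable
   under D and t D, hence is C[t], and L_0 supplies the powers of s.
   If b <> -1 or alpha = 0, then t - c generates an invariant ideal, with
   c = alpha for b = 1 and c = 0 otherwise. *)
Require Import Defs.
From HB Require Import structures.
From Stdlib Require Import Classical.
From mathcomp Require Import all_boot all_order all_algebra.
From mathcomp Require Import complex reals.
From mathcomp Require mpoly.
From mathcomp Require Import ring zify.

Set Implicit Arguments.
Unset Strict Implicit.
Unset Printing Implicit Defensive.

Import Order.TTheory GRing.Theory Num.Theory.
Local Open Scope ring_scope.

(** * Recovering coefficients inside a subspace *)

Section Subspaces.
Variables (K : numFieldType) (V : lmodType K) (N : V -> Prop).
Hypothesis N0 : N 0.
Hypothesis NP : forall (a : K) u v, N u -> N v -> N (a *: u + v).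

Lemma subspaceZ a u : N u -> N (a *: u).
Proof. by move=> Nu; rewrite -[_ *: _]addr0; apply: NP. Qed.

Lemma subspaceD u v : N u -> N v -> N (u + v).
Proof. by move=> Nu Nv; rewrite -[u]scale1r; apply: NP. Qed.

Lemma subspace_sum I (r : seq I) (F : I -> V) :
  (forall i, N (F i)) -> N (\sum_(i <- r) F i).
Proof. by move=> NF; elim/big_ind: _ => // u v; apply: subspaceD. Qed.

(** The Vandermonde matrix at the nodes 0, ..., n-1 is invertible in characteristic 0, so each
    coefficient is a combination of the values at these nodes. *)
Lemma subspace_coef n (v : 'I_n -> V) :
  (forall m : nat, N (\sum_(i < n) m%:R ^+ i *: v i)) -> forall i, N (v i).
Proof.
move=> Nv i.
pose A := Vandermonde n (\row_(j < n) (j%:R : K)).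
have uA : A \in unitmx.
  rewrite unitmxE unitfE det_Vandermonde.
  apply/prodf_neq0 => j _; apply/prodf_neq0 => k lt_jk.
  by rewrite !mxE subr_eq0 eqr_nat gtn_eqF.
(* As A_kj = j^k, the weights form column i of the inverse matrix. *)
have -> : v i = \sum_(j < n) invmx A j i *: \sum_(k < n) j%:R ^+ k *: v k.
  transitivity (\sum_(k < n) (k == i)%:R *: v k).
    rewrite (bigD1 i) //= eqxx scale1r big1 ?addr0 // => k /negPf ->.
    by rewrite scale0r.
  under [RHS]eq_bigr => j _ do rewrite scaler_sumr.
  rewrite exchange_big; apply: eq_bigr => k _ /=.
  under eq_bigr => j _ do rewrite scalerA.
  rewrite -scaler_suml; congr (_ *: _).
  have /matrixP/(_ k i) := mulmxV uA; rewrite !mxE => <-.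
  by apply: eq_bigr => j _; rewrite !mxE mulrC.
by apply: subspace_sum => j; apply: subspaceZ.
Qed.

End Subspaces.

(** * The twisted derivation D = d/dt - g on polynomials in t *)

Section TwistedDerivation.
Variable K : numFieldType.
Implicit Types g p : {poly K}.

Definition tderiv g p : {poly K} := p^`() - g * p.

Lemma tderiv0 g : tderiv g 0 = 0.
Proof. by rewrite /tderiv deriv0 mulr0 subrr. Qed.

(** For p nonzero, g p has degree at least that of p, while p' is zero or of smaller degree, so the
    two differ. *)
Lemma tderiv_eq0 g p : g != 0 -> tderiv g p = 0 -> p = 0.
Proof.
move=> g0 /eqP; rewrite subr_eq0 => /eqP Ep.
apply/eqP/negPn/negP => p0; have := lt_size_deriv p0.
rewrite Ep size_mul //; move: g0 p0; rewrite -!size_poly_gt0.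
by move: (size g) (size p); lia.
Qed.

(** For p nonzero, g p has positive degree and dominates p', so D p is not constant. *)
Lemma tderiv_neq1 g p : (1 < size g)%N -> tderiv g p <> 1.
Proof.
move=> g1 Ep; have g0 : g != 0 by rewrite -size_poly_gt0 (ltn_trans _ g1).
case: (eqVneq p 0) => [p0|p0].
  by move/eqP: Ep; rewrite p0 tderiv0 eq_sym oner_eq0.
have lt_gp : (size p < size (g * p)%R)%N.
  by rewrite size_mul //; move: g1; move: (size g) (size p); lia.
have lt_dp := lt_size_deriv p0.
have := size_poly1 K; rewrite -Ep /tderiv addrC size_polyDl size_polyN.
  by move=> E; move: lt_gp p0; rewrite -size_poly_gt0 E; case: (size p).
exact: ltn_trans lt_gp.
Qed.

(* D = d/dt - c and t D together also give d/dt = D + c, which brings any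
   nonzero polynomial down to a constant; t D then climbs back through the
   powers of t. *)
Lemma tderiv_irreducible (N : {poly K} -> Prop) (c : K) :
  c != 0 -> N 0 -> (forall (a : K) p q, N p -> N q -> N (a *: p + q)) ->
  (forall p, N p -> N (tderiv c%:P p)) ->
  (forall p, N p -> N ('X * tderiv c%:P p)) ->
  forall p, N p -> p != 0 -> forall q, N q.
Proof.
move=> c0 N0 NP ND NtD p Np p0.
have Nd q : N q -> N q^`().
  move=> Nq; have -> : q^`() = c *: q + tderiv c%:P q.
    by rewrite /tderiv mul_polyC subrKC.
  by apply: NP => //; apply: ND.
have N1 : N 1.
  have Ndn n : N p^`(n) by elim: n => [|n IHn] //; rewrite derivnS; apply: Nd.
  (* The derivative of order deg p is the leading coefficient times a factorial, nonzero in
     characteristic 0. *)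
  pose a := lead_coef p *+ (size p).-1`!.
  have a0 : a != 0 by rewrite mulrn_eq0 negb_or lead_coef_eq0 p0 -lt0n fact_gt0.
  have Ea : p^`((size p).-1) = a%:P.
    apply/polyP => i; rewrite coef_derivn coefC; case: i => [|i] /=.
      by rewrite addn0 ffactnn.
    by rewrite nth_default ?mul0rn //; lia.
  have -> : 1 = a^-1 *: p^`((size p).-1).
    by rewrite Ea -mul_polyC -polyCM mulVf.
  exact: (subspaceZ N0 NP).
have NX n : N 'X^n.
  elim: n => [|n IHn]; first by rewrite expr0.
  (* Solve t D(t^n) = n t^n - c t^(n+1) for the top power. *)
  have -> : 'X^(n.+1) = c^-1 *: ('X * ('X^n)^`())
                        + (- c^-1) *: ('X * tderiv c%:P 'X^n).
    rewrite scaleNr -scalerBr -mulrBr /tderiv opprB subrKC mul_polyC -scalerAr.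
    by rewrite scalerA mulVf // scale1r exprS.
  apply: (NP); last by apply: (subspaceZ N0 NP); apply: NtD.
  have -> : 'X * ('X^n)^`() = n%:R *: 'X^n :> {poly K}.
    rewrite derivXn mulrnAr scaler_nat.
    by case: n {IHn} => [|n]; rewrite ?mulr0n // -exprS.
  exact: (subspaceZ N0 NP).
move=> q; rewrite -[q]coefK poly_def.
by apply: (subspace_sum N0 NP) => i; apply: (subspaceZ N0 NP).
Qed.

End TwistedDerivation.

(* The action of lambda^-m L_m on f(s), read as a polynomial in m = 'X. *)
Section PolynomialInM.
Variables (A : idomainType) (s k a t : A) (n : nat) (P R : {poly A}).

(** [P] and [R] stand for f and D f as polynomials in s, [k] for h(alpha), [a] for alpha; composing
    with s - 'X is the shift by m. *)
Definition action_poly : {poly A} :=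
  (s%:P + 'X * k%:P) * (P \Po (s%:P - 'X))
  + ('X^2 * a%:P - 'X * t%:P) * (R \Po (s%:P - 'X)).

Lemma horner_action_poly x : action_poly.[x] =
  (s + x * k) * P.[s - x] + (x ^+ 2 * a - x * t) * R.[s - x].
Proof. by rewrite /action_poly !hornerE !horner_comp !hornerE. Qed.

(** The first summand has degree at most n+1 in 'X; of the second, only 'X^2 a R(s - 'X) reaches
    n+2, and the substitution brings the sign. *)
Lemma coef_action_poly : (size P <= n.+1)%N -> (size R <= n.+1)%N ->
  action_poly`_n.+2 = (-1) ^+ n * a * R`_n.
Proof.
move=> sP sR; have sizeS : size (s%:P - 'X) = 2%N.
  by rewrite -opprB size_polyN size_XsubC.
have RE : (R \Po (s%:P - 'X))`_n = (-1) ^+ n * R`_n.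
  have [sRn|sRn] := eqVneq (size R) n.+1; last first.
    by rewrite !nth_default ?mulr0 ?size_comp_poly2 // -ltnS ltn_neqAle sRn.
  have := lead_coef_comp R (_ : (1 < size (s%:P - 'X)%R)%N); rewrite sizeS.
  move=> /(_ isT); rewrite !lead_coefE size_comp_poly2 // sRn sizeS mulrC /= => ->.
  by rewrite coefB coefC coefX /= sub0r.
rewrite /action_poly coefD nth_default ?add0r; last first.
  apply: leq_trans (size_polyMleq _ _) _; rewrite size_comp_poly2 //.
  suff : (size (s%:P + 'X * k%:P)%R <= 2)%N by lia.
  apply: leq_trans (size_polyD _ _) _; rewrite geq_max.
  have sC := size_polyC_leq1; apply/andP; split; first exact: leqW (sC _ s).
  apply: leq_trans (size_polyMleq _ _) _; rewrite size_polyX.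
  by have := sC _ k; lia.
rewrite mulrBl -!mulrA coefB !coefXM /= !coefCM.
rewrite [X in t * X]nth_default ?size_comp_poly2 // mulr0 subr0 RE.
by rewrite mulrCA.
Qed.

End PolynomialInM.

(** * Polynomials in s and t, and the action on them *)

Section PhiSubmodules.
Import mpoly.
Variable K : numFieldType.
Implicit Types (p : {poly K}) (f : {mpoly K[2]}).
Local Notation s := ('X_si : {mpoly K[2]}).
Local Notation t := ('X_ti : {mpoly K[2]}).

(** Evaluation at s = 0, a left inverse of [at_t] that commutes with d/dt. *)
Definition at_s0 f : {poly K} :=
  mmap (@polyC K) (fun i : 'I_2 => if i == ti then 'X else 0) f.

Lemma at_s0_s : at_s0 s = 0.
Proof. by rewrite /at_s0 mmapX mmap1U. Qed.

Lemma at_s0_t : at_s0 t = 'X.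
Proof. by rewrite /at_s0 mmapX mmap1U. Qed.

Lemma at_s0_C c : at_s0 c%:MP = c%:P.
Proof. by rewrite /at_s0 mmapC. Qed.

Lemma at_s0D : {morph at_s0 : f g / f + g}.
Proof. by move=> f g; rewrite /at_s0 rmorphD. Qed.

Lemma at_s0M : {morph at_s0 : f g / f * g}.
Proof. by move=> f g; rewrite /at_s0 rmorphM. Qed.

Lemma at_s0_at_t p : at_s0 (at_t p) = p.
Proof.
elim/poly_ind: p => [|p c IHp]; first by rewrite -[0]polyC0 at_tC at_s0_C.
by rewrite at_tD at_tM at_tX at_tC at_s0D at_s0M IHp at_s0_t at_s0_C.
Qed.

Lemma at_s0_deriv f : at_s0 f^`M(ti) = (at_s0 f)^`().
Proof.
elim/mpoly2_ind: f => [c|||f g IHf IHg|f g IHf IHg].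
- by rewrite mderivC at_s0_C derivC -mpolyC0 at_s0_C.
- by rewrite mderivt_s at_s0_s deriv0 -mpolyC0 at_s0_C.
- by rewrite mderivt_t at_s0_t derivX -mpolyC1 at_s0_C.
- by rewrite mderivD !at_s0D derivD IHf IHg.
- by rewrite mderivM at_s0M derivM at_s0D !at_s0M IHf IHg.
Qed.

Lemma at_t_inj : injective (@at_t K).
Proof. exact: can_inj at_s0_at_t. Qed.

Lemma at_t0 : at_t 0 = 0 :> {mpoly K[2]}.
Proof. by rewrite -polyC0 at_tC. Qed.

Lemma at_t1 : at_t 1 = 1 :> {mpoly K[2]}.
Proof. by rewrite -polyC1 at_tC. Qed.

Lemma at_t_zmod : zmod_morphism (@at_t K).
Proof. exact: at_tB. Qed.

Lemma at_t_monoid : monoid_morphism (@at_t K).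
Proof. by split; [exact: at_t1 | exact: at_tM]. Qed.

HB.instance Definition _ :=
  GRing.isZmodMorphism.Build {poly K} {mpoly K[2]} (@at_t K) at_t_zmod.
HB.instance Definition _ :=
  GRing.isMonoidMorphism.Build {poly K} {mpoly K[2]} (@at_t K) at_t_monoid.

(** K[s, t] as K[t][s]: the values at s of such [F] form a ring containing the constants, s and
    t. *)
Lemma poly_in_s f :
  exists F : {poly {poly K}}, f = \sum_(i < size F) at_t F`_i * s ^+ i.
Proof.
suff [F ->] : exists F : {poly {poly K}}, f = (map_poly (@at_t K) F).[s].
  exists F; rewrite horner_coef (size_map_inj_poly at_t_inj at_t0).
  by apply: eq_bigr => i _; rewrite coef_map.
elim/mpoly2_ind: f => [c|||f g [F ->] [G ->]|f g [F ->] [G ->]].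
- by exists c%:P%:P; rewrite map_polyC hornerC /= at_tC.
- by exists 'X; rewrite map_polyX hornerX.
- by exists 'X%:P; rewrite map_polyC hornerC /= at_tX.
- by exists (F + G); rewrite rmorphD hornerD.
- by exists (F * G); rewrite rmorphM hornerM.
Qed.

(** The extension of [tderiv] to K[s, t] that is linear over K[s]. *)
Definition mtderiv g f : {mpoly K[2]} := f^`M(ti) - at_t g * f.

Lemma mtderiv_at_t g p : mtderiv g (at_t p) = at_t (tderiv g p).
Proof. by rewrite /mtderiv /tderiv mderivt_at_t at_tB at_tM. Qed.

Lemma at_s0_mtderiv g f : at_s0 (mtderiv g f) = tderiv g (at_s0 f).
Proof.
rewrite /mtderiv /tderiv -mulNr at_s0D at_s0M at_s0_deriv.
by rewrite -[- at_t g]raddfN at_s0_at_t mulNr.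
Qed.

Lemma mtderiv0 g : mtderiv g 0 = 0.
Proof. by rewrite /mtderiv mderiv0 mulr0 subrr. Qed.

Lemma mtderivD g u v : mtderiv g (u + v) = mtderiv g u + mtderiv g v.
Proof. by rewrite /mtderiv mderivD; ring. Qed.

Lemma mtderivM g u v : mtderiv g (u * v) = u^`M(ti) * v + u * mtderiv g v.
Proof. by rewrite /mtderiv mderivM; ring. Qed.

Lemma mtderivZ g a u : mtderiv g (a *: u) = a *: mtderiv g u.
Proof. by rewrite /mtderiv mderivZ scalerBr -scalerAr. Qed.

Lemma mtderiv_shift g m f : shift_s m (mtderiv g f) = mtderiv g (shift_s m f).
Proof. by rewrite /mtderiv shift_sB shift_sM shift_at_t mderivt_shift. Qed.

Lemma shift_s0 f : shift_s 0 f = f.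
Proof.
elim/mpoly2_ind: f => [c|||f g IHf IHg|f g IHf IHg].
- exact: shift_sC.
- by rewrite shift_ss mpolyC0 subr0.
- exact: shift_st.
- by rewrite shift_sD IHf IHg.
- by rewrite shift_sM IHf IHg.
Qed.

Lemma shift_sum_s m n (F : nat -> {poly K}) :
  shift_s m (\sum_(i < n) at_t (F i) * s ^+ i) =
    \sum_(i < n) at_t (F i) * (s - (m%:~R)%:MP) ^+ i.
Proof.
rewrite (big_morph _ (shift_sD m) (_ : _ = 0)); last first.
  by rewrite -mpolyC0 shift_sC.
apply: eq_bigr => i _; rewrite shift_sM shift_at_t; congr (_ * _).
elim: (i : nat) => [|j IHj]; first by rewrite !expr0 -mpolyC1 shift_sC.
by rewrite !exprS shift_sM shift_ss IHj.
Qed.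

Lemma mderivt_sXn i : (s ^+ i)^`M(ti) = 0.
Proof.
elim: i => [|i IHi]; first by rewrite expr0 -mpolyC1 mderivC.
by rewrite exprS mderivM mderivt_s IHi mul0r mulr0 addr0.
Qed.

Lemma mtderiv_sum_s g n (F : nat -> {poly K}) :
  mtderiv g (\sum_(i < n) at_t (F i) * s ^+ i) =
    \sum_(i < n) at_t (tderiv g (F i)) * s ^+ i.
Proof.
rewrite (big_morph _ (mtderivD g) (mtderiv0 g)).
apply: eq_bigr => i _.
by rewrite mulrC mtderivM mderivt_sXn mul0r add0r mtderiv_at_t mulrC.
Qed.

(** Vandermonde extraction for polynomials in m with coefficients in K[s, t]. *)
Lemma subspace_horner (N : {mpoly K[2]} -> Prop) (Q : {poly {mpoly K[2]}}) :
  N 0 -> (forall (a : K) u v, N u -> N v -> N (a *: u + v)) ->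
  (forall m : nat, N Q.[(m%:R)%:MP]) -> forall i, N Q`_i.
Proof.
move=> N0 NP NQ i.
case: (ltnP i (size Q)) => [lt_i|le_i]; last by rewrite nth_default.
pose v (j : 'I_(size Q)) := Q`_j.
apply: (subspace_coef N0 NP (v := v) _ (Ordinal lt_i)) => m.
have := NQ m; rewrite horner_coef; congr (N _).
by apply: eq_bigr => j _; rewrite mulrC -rmorphXn mul_mpolyC.
Qed.

Lemma size_phi_g (alpha : K) (h : {poly K}) :
  size (phi_g alpha h) = (size h).-1.
Proof.
rewrite /phi_g size_divp ?polyXsubC_eq0 // size_XsubC /= subn1.
case: (leqP (size h) 1) => [/size1_polyC ->|h1].
  by rewrite hornerC subrr size_poly0 size_polyC; case: eqP.
rewrite size_polyDl // size_polyN.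
exact: leq_ltn_trans (size_polyC_leq1 _) h1.
Qed.

(** * Submodules of Phi *)

Variables (b alpha lambda : K) (lambda_neq0 : lambda != 0) (h : {poly K}).
Local Notation M := (Phi b alpha h lambda_neq0).
Local Notation g := (phi_g alpha h).
Local Notation k := (h.[alpha]).

Lemma is_submodule_phi_L (N : {mpoly K[2]} -> Prop) :
  N 0 -> (forall (a : K) u v, N u -> N v -> N (a *: u + v)) ->
  (forall m f, N f -> N (phi_L b lambda alpha h m f)) ->
  @is_submodule K (virasoro K) M N.
Proof.
move=> N0 NP NL; split=> // x f Nf.
change (N (phi_act b lambda alpha h x f)).
elim/vir_space_ind: x => [|a u v IHu IHv|[m|]].
- by rewrite /phi_act /lin_ext monalg.msupp0 finmap.big_seq_fset0.
- by rewrite phi_act_linearl; apply: (NP).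
- by rewrite phi_act_basis; apply: NL.
- by rewrite phi_act_basis.
Qed.

Lemma submodule_phi_L (N : M -> Prop) m (f : {mpoly K[2]}) :
  is_submodule N -> N f -> N (phi_L b lambda alpha h m f).
Proof.
case=> _ _ Nact Nf; have := Nact (vir_L K m) f Nf.
by rewrite [lie_act _ _](phi_act_basis b lambda alpha h (Some m) f).
Qed.

Definition phi_c : K := (b == 1)%:R * alpha.

(** Once the term in m alpha vanishes, d/dt enters L_m with the factor t - c; shifting in s fixes t
    - c. *)
Lemma phi_ideal_submodule : (b == -1)%:R * alpha = 0 ->
  @is_submodule K (virasoro K) M
    (fun f => exists q, f = (t - phi_c%:MP) * q).
Proof.
move=> ba; apply: is_submodule_phi_L => [|a _ _ [q ->] [r ->]|m _ [q ->]].
- by exists 0; rewrite mulr0.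
- by exists (a *: q + r); rewrite mulrDr -scalerAr.
rewrite /phi_L -mulrA [m%:~R * alpha]mulrC mulrA ba mul0r mpolyC0 subr0 -/phi_c.
rewrite shift_sM shift_sB shift_st shift_sC.
set d := mderiv _ _; set q' := shift_s m q; set A := s + _; set T := t - _.
(* The derivative [d] stays unexpanded: its coefficient already contains t - c. *)
exists (lambda ^ m *: (A * q' + (b * m%:~R) *: d)).
by rewrite -scalerAr mulrDr scalerAr -scalerAr mulrCA.
Qed.

(** * The case b = -1 *)

Section BMinus1.
Hypothesis bN1 : b = -1.

(** After substituting h = k + (t - alpha) g, the terms m alpha g cancel; the rest of g has the
    coefficient of d/dt with opposite sign, and the two combine into D. *)
Lemma phi_L_mtderiv m f :
  phi_L b lambda alpha h m f =
    (lambda ^ m)%:MP *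
      ((s + (m%:~R)%:MP * k%:MP) * shift_s m f
       + ((m%:~R)%:MP ^+ 2 * alpha%:MP - (m%:~R)%:MP * t)
         * mtderiv g (shift_s m f)).
Proof.
rewrite phi_LE // /mtderiv -mderivt_shift.
rewrite /phi_e /phi_h bN1 eqxx eqN11 /= at_tB !at_tZ !at_tB at_tX !at_tC.
have := congr1 (@at_t K) (phi_gP alpha h).
rewrite at_tD at_tM at_tB at_tX !at_tC => ->.
rewrite !(mpolyCM, mpolyCN, mpolyCD, mpolyCB, mpolyC0, mpolyC1).
ring.
Qed.

(** With g = 0 the D term vanishes on the kernel, and s + m k is free of t. *)
Lemma phi_kernel_submodule : g = 0 ->
  @is_submodule K (virasoro K) M (fun f => f^`M(ti) = 0).
Proof.
move=> g0; apply: is_submodule_phi_L => [|a u v du dv|m f df].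
- exact: mderiv0.
- by rewrite mderivD mderivZ du dv scaler0 addr0.
have dsf : (shift_s m f)^`M(ti) = 0.
  by rewrite mderivt_shift df -mpolyC0 shift_sC.
rewrite phi_L_mtderiv /mtderiv dsf g0 at_t0 mul0r subr0 mulr0 addr0 -mpolyCM.
by rewrite !mderivM dsf mderivD !mderivC mderivt_s; ring.
Qed.

(* t D^2 = D (t D) - D, so L_m maps D q to D (L_m q + m lambda^m q(s - m, t)). *)
Lemma phi_image_submodule :
  @is_submodule K (virasoro K) M (fun f => exists q, f = mtderiv g q).
Proof.
apply: is_submodule_phi_L => [|a _ _ [q ->] [r ->]|m _ [q ->]].
- by exists 0; rewrite mtderiv0.
- by exists (a *: q + r); rewrite mtderivD mtderivZ.
rewrite phi_L_mtderiv mtderiv_shift; set q' := shift_s m q.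
set A := s + _; set B := _ - _; set l := (lambda ^ m)%:MP.
exists (l * (A * q' + B * mtderiv g q' + (m%:~R)%:MP * q')).
have dA : A^`M(ti) = 0.
  by rewrite /A -mpolyCM mderivD mderivC mderivt_s addr0.
have dB : B^`M(ti) = - (m%:~R)%:MP.
  rewrite /B expr2 -!mpolyCM mderivB mderivM !mderivC mderivt_t.
  by rewrite mul0r mulr1 !add0r.
by rewrite !(mtderivM, mtderivD) dA dB !mderivC; ring.
Qed.

(** * Nonzero submodules when alpha is nonzero and g is a nonzero constant *)

Section Irreducible.
Hypotheses (alpha_neq0 : alpha != 0) (c : K) (c_neq0 : c != 0).
Hypothesis gc : g = c%:P.
Variable N : {mpoly K[2]} -> Prop.
Hypothesis subN : @is_submodule K (virasoro K) M N.

Let N0 : N 0. Proof. exact: submodule0 subN. Qed.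
Let NP (a : K) u v : N u -> N v -> N (a *: u + v).
Proof. exact: (submoduleP subN). Qed.

(** Removing lambda^m leaves a polynomial in m; natural m suffice to extract its coefficients. *)
Lemma submodule_unscaled (m : nat) f : N f ->
  N ((s + (m%:R)%:MP * k%:MP) * shift_s m f
     + ((m%:R)%:MP ^+ 2 * alpha%:MP - (m%:R)%:MP * t)
       * mtderiv c%:P (shift_s m f)).
Proof.
move=> Nf; have := submodule_phi_L m subN Nf.
rewrite phi_L_mtderiv gc mul_mpolyC => /(subspaceZ N0 NP (lambda ^ m)^-1).
by rewrite scalerA mulVf ?scale1r // expfz_neq0.
Qed.

Lemma submodule_mul_s f : N f -> N (s * f).
Proof.
move/(submodule_unscaled 0); rewrite shift_s0 mpolyC0 expr0n !mul0r addr0 subr0.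
by rewrite mul0r addr0.
Qed.

(** The shift fixes p, so lambda^-m L_m p = s p + m (k p - t D p) + m^2 alpha D p. Divide the last
    coefficient by alpha and remove k p from the middle one. *)
Lemma submodule_tderiv p : N (at_t p) ->
  N (at_t (tderiv c%:P p)) /\ N (at_t ('X * tderiv c%:P p)).
Proof.
move=> Np; set q := tderiv _ _.
pose v := [:: s * at_t p; k *: at_t p - t * at_t q; alpha *: at_t q].
have Nv i : (i < 3)%N -> N v`_i.
  move=> lt_i.
  pose v' (j : 'I_3) := v`_j.
  apply: (subspace_coef N0 NP (v := v') _ (Ordinal lt_i)) => m.
  have := submodule_unscaled m Np; rewrite shift_at_t mtderiv_at_t -/q.
  congr (N _); rewrite !big_ord_recl big_ord0 /v' /v /= /bump /= !scaleMP.
  rewrite expr0 expr1 expr2 mpolyC1 mpolyCM.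
  move: (at_t p) (at_t q) ((m%:R)%:MP) => P Q n. ring.
have N1 : N (k *: at_t p - t * at_t q) by exact: (Nv 1%N isT).
have N2 : N (alpha *: at_t q) by exact: (Nv 2%N isT).
split.
  have := subspaceZ N0 NP alpha^-1 N2.
  by rewrite scalerA mulVf // scale1r.
have := NP (-1) N1 (subspaceZ N0 NP k Np).
by rewrite scaleN1r opprB subrK at_tM at_tX.
Qed.

(* The top coefficient in m of lambda^-m L_m f is +- alpha (D p), where p is
   the leading coefficient of f as a polynomial in s. *)
Lemma submodule_meets_at_t f : N f -> f != 0 ->
  exists2 p, p != 0 & N (at_t p).
Proof.
have [F ->] := poly_in_s f => Nf f0.
have F0 : F != 0.
  by apply: contraNneq f0 => ->; rewrite size_poly0 big_ord0.
set f' := \sum_(i < _) _ in Nf.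
pose n := (size F).-1.
have nE : size F = n.+1 by rewrite /n prednK // size_poly_gt0.
(* The coefficients in s of f and of D f; at s - m these polynomials give the shifts. *)
pose P : {poly {mpoly K[2]}} := \poly_(i < n.+1) at_t F`_i.
pose R : {poly {mpoly K[2]}} := \poly_(i < n.+1) at_t (tderiv c%:P F`_i).
have NQ i : N (action_poly s k%:MP alpha%:MP t P R)`_i.
  apply: subspace_horner => // m; rewrite horner_action_poly.
  rewrite /P /R !horner_poly.
  have := submodule_unscaled m Nf.
  rewrite -mtderiv_shift mtderiv_sum_s shift_sum_s nE.
  by rewrite (shift_sum_s _ _ (fun i => tderiv c%:P F`_i)).
have := NQ n.+2; rewrite coef_action_poly ?size_poly // coef_poly ltnSn.
rewrite [F`_n]lead_coefE => Np; exists (tderiv c%:P (lead_coef F)).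
  (* D is injective because c is nonzero. *)
  rewrite -lead_coef_eq0 in F0; apply: contra_neq F0.
  by apply: tderiv_eq0; rewrite polyC_eq0.
have e0 : (-1) ^+ n * alpha != 0 by rewrite mulf_neq0 ?signr_eq0.
rewrite -[at_t _]scale1r -(mulVf e0) -scalerA; apply: (subspaceZ N0 NP).
by rewrite scaleMP mpolyCM rmorphXn /= mpolyCN mpolyC1.
Qed.

Lemma submodule_all f : N f -> f != 0 -> forall f', N f'.
Proof.
move=> Nf f0; have [p p0 Np] := submodule_meets_at_t Nf f0.
have Nt q : N (at_t q).
  apply: (tderiv_irreducible (N := fun q => N (at_t q)) c_neq0 _ _ _ _ Np p0).
  - by rewrite at_t0.
  - by move=> a q1 q2 N1 N2; rewrite at_tD at_tZ -scaleMP; apply: NP.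
  - by move=> r /submodule_tderiv[].
  - by move=> r /submodule_tderiv[].
move=> f'; have [F ->] := poly_in_s f'.
apply: (subspace_sum N0 NP) => i; rewrite mulrC.
have := Nt F`_i; move: (at_t _) => u Nu.
elim: (i : nat) => [|j IHj]; first by rewrite expr0 mul1r.
by rewrite exprS -mulrA; apply: submodule_mul_s.
Qed.

End Irreducible.

Lemma phi_irreducible : alpha != 0 -> size h = 2%N -> irreducible M.
Proof.
move=> alpha0 h2; have := size_phi_g alpha h; rewrite h2 => /eqP/size_poly1P.
move=> [c c0 gc]; split; first by exists (1 : {mpoly K[2]}); apply/eqP/oner_neq0.
move=> N sN; case: (classic (forall v, N v -> v = 0)) => [|nN]; first by left.
right => v; apply: NNPP => Nv; apply: nN => w Nw.
apply/eqP/negPn/negP => w0; apply: Nv.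
exact: (submodule_all alpha0 c0 gc sN Nw w0).
Qed.

End BMinus1.

(** * Proper submodules in the remaining cases *)

Lemma phi_reducible (N : {mpoly K[2]} -> Prop) f f' :
  @is_submodule K (virasoro K) M N -> N f -> f <> 0 -> ~ N f' ->
  ~ irreducible M.
Proof.
move=> sN Nf f0 Nf' [_ /(_ N sN)[N0|Nall]]; first exact: f0 (N0 f Nf).
exact: Nf' (Nall f').
Qed.

Lemma phi_irreducible_b_alpha : irreducible M -> b = -1 /\ alpha != 0.
Proof.
move=> irr; suff : (b == -1) && (alpha != 0) by case/andP => /eqP.
apply: contraT => ba; exfalso; move: irr.
have e0 : (b == -1)%:R * alpha = 0.
  move: ba; rewrite negb_and negbK; case: eqP => _ /=; rewrite ?mul0r //.
  by move/eqP->; rewrite mulr0.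
apply: (phi_reducible (f := t - phi_c%:MP) (f' := 1) (phi_ideal_submodule e0)).
- by exists 1; rewrite mulr1.
- move/(congr1 (mderiv ti)); rewrite mderivB mderivC mderivt_t subr0 mderiv0.
  by apply/eqP/oner_neq0.
(* Evaluation at s = 0, t = c kills the ideal but not 1. *)
- case=> q /(congr1 (meval (fun i => if i == ti then phi_c else 0))).
  rewrite meval1 mevalM mevalB mevalXU eqxx mevalC subrr mul0r.
  by apply/eqP/oner_neq0.
Qed.

Lemma phi_irreducibleP :
  irreducible M <-> b = -1 /\ alpha != 0 /\ size h = 2%N.
Proof.
split=> [irr|[bN1 [alpha0 h2]]]; last exact: phi_irreducible.
have [bN1 alpha0] := phi_irreducible_b_alpha irr; do 2!split=> //.
apply/eqP/negPn/negP => h2; move: irr.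
(* For h constant, ker d/dt contains 1 but not t. *)
have [h1|h1] := leqP (size h) 1.
  have g0 : g = 0.
    by apply/eqP; rewrite -size_poly_eq0 size_phi_g; case: (size h) h1 => [|[]].
  apply: (phi_reducible (f := 1) (f' := t) (phi_kernel_submodule bN1 g0)).
  - by rewrite -mpolyC1 mderivC.
  - by apply/eqP/oner_neq0.
  - by rewrite mderivt_t; apply/eqP/oner_neq0.
(* For deg h at least 2, g is not constant: im D contains D 1 = -g, which is nonzero, but not 1. *)
have g1 : (1 < size g)%N by rewrite size_phi_g; move: h1 h2; lia.
apply: (phi_reducible (f := mtderiv g 1) (f' := 1) (phi_image_submodule bN1)).
- by exists 1.
- have g0 : g != 0 by rewrite -size_poly_gt0 ltnW.
  rewrite -at_t1 mtderiv_at_t -at_t0 => /at_t_inj/(tderiv_eq0 g0)/eqP.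
  by rewrite oner_eq0.
(* Setting s = 0 reduces this to one variable. *)
- case=> q /(congr1 at_s0); rewrite at_s0_mtderiv -at_t1 at_s0_at_t => /esym.
  exact: tderiv_neq1.
Qed.
End PhiSubmodules.

Local Open Scope complex_scope.

(** [size] is the degree plus one, so size 2 means degree one. *)
Theorem theorem3p2 (R : realType) (b alpha lambda : R[i])
    (lambda_neq0 : lambda != 0) (h : {poly R[i]}) :
  irreducible (Phi b alpha h lambda_neq0) <->
    b = -1 /\ alpha != 0 /\ size h = 2%N.
Proof. exact: phi_irreducibleP. Qed.
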